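(* Let $a<b$ be real numbers, let $1<p<\infty$, let $R=\frac{b-a}{2}$, and let $(V,W)$ be a $p$-Bessel pair on $(0,R')$ for some $R'>R$, with positive solution $\varphi$. Let $d(t)=\min\{t-a,b-t\}$. Then, for every $u\in C_0^\infty(a,b)$, $$\int_a^bV(d(t))|u'(t)|^pdt-\int_a^bW(d(t))|u(t)|^pdt=\int_a^bV(d(t))\,C_p\!\left(u'(t),\ \varphi(d(t))\left(\frac{u(t)}{\varphi(d(t))}\right)'\right)dt+2\,\frac{V(R)|\varphi'(R)|^{p-2}\varphi'(R)}{\varphi(R)^{p-1}}\left|u\!\left(\frac{a+b}2\right)\right|^p .$$ In particular, if $R$ is a critical point of $\varphi$, then $$\int_a^bV(d(t))|u'(t)|^pdt-\int_a^bW(d(t))|u(t)|^pdt=\int_a^bV(d(t))\,C_p\!\left(u'(t),\ \varphi(d(t))\left(\frac{u(t)}{\varphi(d(t))}\right)'\right)dt .$$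
   Context: For $0<R'\le\infty$ and $1<p<\infty$, a pair $(V,W)$ of positive $C^1$ functions on $(0,R')$ is a $p$-Bessel pair on $(0,R')$ if the ODE $(V|y'|^{p-2}y')'+W|y|^{p-2}y=0$ has a positive $C^1$ solution $\varphi$ on $(0,R')$; such a $\varphi$ is called a positive solution of the pair. Convention: if $1<p<2$, $\varphi'$ is assumed to have constant sign on $(0,R')$. For $x,y\in\mathbb{R}$, $C_p(x,y)=|x|^p-|x-y|^p-p|x-y|^{p-2}(x-y)y$. Derivatives of expressions involving $d$ are taken almost everywhere. *)

(* Defs.v *)
From HB Require Import structures.
From mathcomp Require Import all_boot all_order all_algebra.
From mathcomp Require Import all_classical all_reals all_analysis.

Set Implicit Arguments.
Unset Strict Implicit.
Unset Printing Implicit Defensive.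

Import Order.TTheory GRing.Theory Num.Theory.
Import numFieldNormedType.Exports.

Local Open Scope classical_set_scope.
Local Open Scope ring_scope.

(* The interval (0, R') with 0 < R' <= +oo. *)
Definition pos_interval (R : realType) (R' : \bar R) : set R :=
  [set r | 0 < r /\ (r%:E < R')%E].

(* Meant for open [D]: derivatives and continuity are two-sided. *)
Definition C1_on (R : realType) (D : set R) (f : R -> R) : Prop :=
  forall r, D r -> derivable f r 1 /\ {for r, continuous (derive1 f)}.

(* |x|^(p-2) x; since 0 `^ q is 0 or 1, the value at x = 0 is 0 for every p,
   including 1 < p < 2, where |x|^(p-2) alone is singular. *)
Definition sgn_pow (R : realType) (p x : R) : R := `|x| `^ (p - 2) * x.

(* (V |y'|^(p-2) y')' + W |y|^(p-2) y = 0 on D, in the classical sense. *)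
Definition solves_ode (R : realType) (p : R) (D : set R) (V W y : R -> R) :
    Prop :=
  let flux := fun s => V s * sgn_pow p (derive1 y s) in
  forall r, D r ->
    derivable flux r 1 /\ derive1 flux r + W r * sgn_pow p (y r) = 0.

(* The sign condition is weak (phi' may vanish), so that a critical point of
   phi is not excluded when p < 2. *)
Definition positive_solution (R : realType) (p : R) (R' : \bar R)
    (V W phi : R -> R) : Prop :=
  let D := pos_interval R' in
  [/\ C1_on D phi,
      (forall r, D r -> 0 < phi r),
      solves_ode p D V W phi &
      p < 2 -> (forall r, D r -> 0 <= derive1 phi r) \/
               (forall r, D r -> derive1 phi r <= 0)].

Definition bessel_pair (R : realType) (p : R) (R' : \bar R) (V W : R -> R) :
    Prop :=
  let D := pos_interval R' in
  [/\ (0 < R')%E,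
      C1_on D V /\ (forall r, D r -> 0 < V r),
      C1_on D W /\ (forall r, D r -> 0 < W r) &
      exists phi, positive_solution p R' V W phi].

Definition Cp (R : realType) (p x y : R) : R :=
  `|x| `^ p - `|x - y| `^ p - p * sgn_pow p (x - y) * y.

(* C_0^oo(a, b), each function being extended by 0 to the whole line. *)
Definition test_function (R : realType) (a b : R) (u : R -> R) : Prop :=
  let supp := closure [set t | u t != 0] in
  [/\ (forall (n : nat) (t : R), derivable (derive1n n u) t 1),
      compact supp & supp `<=` `]a, b[].

(* Main.v *)
Require Import Defs.
From HB Require Import structures.
From mathcomp Require Import all_boot all_order all_algebra.
From mathcomp Require Import all_classical all_reals all_analysis.
From mathcomp Require Import measurable_realfun ring lra.
Import Order.TTheory GRing.Theory Num.Theory.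
Import numFieldNormedType.Exports.

Local Open Scope classical_set_scope.
Local Open Scope ring_scope.

(** The identity is an integrated Picone identity. Write J x = |x|^(p-2) x, so
    that J is multiplicative and J x * x = |x|^p. If f > 0 solves
    (v J(f'))' + w J(f) = 0 and q = u / f, then u' - f q' = f' q, hence

      Cp(u', f q') = |u'|^p - |f'|^p |q|^p - p J(f') J(q) f q',

    and the product rule together with the equation gives the pointwise identity

      (v J(f') f |q|^p)' = v |u'|^p - w |u|^p - v Cp(u', f q')

    ([picone_derive]). Writing the boundary flux with f |u / f|^p instead of
    |u|^p / f^(p-1) means that only x |-> |x|^p has to be differentiated, and
    that the derivative of u / f which occurs in Cp appears by itself.
    Integrating over a compact interval on which everything is C^1 gives
    [picone_integral].

    The distance to the boundary is t - a on the left half of (a, b) and b - t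
    on the right half. The equation is invariant under the maps
    s |-> sigma s + c with sigma = 1 or -1 ([solves_ode_iso]), since its flux is
    odd in f' and is differentiated once more; so f = phi o d solves it on each
    half, with coefficients V o d and W o d ([picone_distance]). The test
    function vanishes near a and near b, where phi and the coefficients may
    degenerate; these end pieces contribute nothing ([balance_vanishing]).
    The only boundary terms left are those at the midpoint. The flux
    V(d) J((phi o d)') jumps there from V(R) J(phi'(R)) to its opposite,
    because d' changes sign, so the two contributions add up instead of
    cancelling: this is the factor 2. *)

Set Implicit Arguments.
Unset Strict Implicit.
Unset Printing Implicit Defensive.

(** * The odd power |x|^(p-2) x *)

Section sgn_pow.
Context (R : realType).
Implicit Types p x y z : R.

Lemma sgn_powM p x y : sgn_pow p (x * y) = sgn_pow p x * sgn_pow p y.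
Proof. by rewrite /sgn_pow normrM powRM// mulrACA. Qed.

Lemma normr_sgn_pow p x : 1 < p -> `|sgn_pow p x| = `|x| `^ (p - 1).
Proof.
move=> p1; rewrite /sgn_pow normrM ger0_norm ?powR_ge0// mulrC.
rewrite -[in LHS](_ : p - 1 - 1 = p - 2); last by ring.
by rewrite mulr_powRB1// subr_gt0.
Qed.

Lemma sgn_pow_mul_id p x : 1 < p -> sgn_pow p x * x = `|x| `^ p.
Proof.
move=> p1; have -> : sgn_pow p x * x = `|sgn_pow p x| * `|x|.
  rewrite /sgn_pow normrM (ger0_norm (powR_ge0 _ _)) -mulrA -!expr2.
  by rewrite -mulrA -expr2 real_normK ?num_real.
by rewrite normr_sgn_pow// mulrC mulr_powRB1// (lt_trans _ p1).
Qed.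

Lemma sgn_pow0 p : sgn_pow p 0 = 0 :> R.
Proof. by rewrite /sgn_pow mulr0. Qed.

(** At 0 the factor |x|^(p-2) is singular when p < 2, but the product is
    dominated by |x|^(p-1), which tends to 0 since p > 1. *)
Lemma continuous_sgn_pow p x : 1 < p -> {for x, continuous (sgn_pow p)}.
Proof.
move=> p1; have [->|x0] := eqVneq x 0.
  apply/cvgrPdist_lt => e e0; rewrite sgn_pow0.
  have p10 : 0 < p - 1 by rewrite subr_gt0.
  have d0 : 0 < e `^ (p - 1)^-1 by rewrite powR_gt0.
  near=> z; rewrite sub0r normrN normr_sgn_pow//.
  have ez : `|z| < e `^ (p - 1)^-1.
    by near: z; exact: cvgr0_norm_lt (@cvg_id _ _) _ d0.
  have -> : e = (e `^ (p - 1)^-1) `^ (p - 1).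
    by rewrite -powRrM mulVf ?lt0r_neq0// powRr1// ltW.
  by apply: gt0_ltr_powR => //; rewrite nnegrE// powR_ge0.
have cx : {for x, continuous (fun z => `|z| `^ (p - 2))}.
  apply: (@continuous_comp _ _ _ (@Num.norm _ R) (fun z => z `^ (p - 2))).
    exact: norm_continuous.
  apply/differentiable_continuous/derivable1_diffP/derivable_powR.
  by rewrite in_itv/= andbT normr_gt0.
exact: (cvgM cx (@cvg_id _ _)).
Unshelve. all: end_near. Qed.

(** Away from 0 this is the chain rule on each half-line. At 0 the difference
    quotient of |z|^p is exactly [sgn_pow p z], so differentiability there is
    the continuity of [sgn_pow p] (Caratheodory's criterion). *)
Lemma is_derive_norm_powR p x : 1 < p ->
  is_derive x 1 (fun z => `|z| `^ p) (p * sgn_pow p x).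
Proof.
move=> p1; have [->|x0] := eqVneq x 0.
  apply/is_derive1_caratheodory; exists (sgn_pow p); split.
  - move=> z; rewrite normr0 powR0 ?subr0 ?sgn_pow_mul_id//.
    by rewrite gt_eqF// (lt_trans _ p1).
  - exact: continuous_sgn_pow.
  - by rewrite sgn_pow0 mulr0.

have p0 : is_derive (`|x|) 1 (fun z => z `^ p) (p * `|x| `^ (p - 1)).
  by apply: is_derive1_powR; rewrite normr_gt0.
have e : `|x| `^ (p - 1) = `|x| `^ (p - 2) * `|x|.
  rewrite mulrC -[in RHS](_ : p - 1 - 1 = p - 2); last by ring.
  by rewrite mulr_powRB1// subr_gt0.
have [xgt0|xlt0|/eqP] := ltgtP x 0; last by rewrite (negbTE x0).
- have nx : is_derive x 1 (@Num.norm _ R) (-1).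
    apply: near_eq_is_derive (is_deriveNid x 1).
    near=> z; rewrite ltr0_norm//; near: z; exact: lt_nbhsl.
  apply: is_derive_eq (is_derive1_comp p0 nx) _.
  by rewrite e /sgn_pow (ltr0_norm xgt0); ring.
- have nx : is_derive x 1 (@Num.norm _ R) 1.
    apply: near_eq_is_derive (is_derive_id x 1).
    near=> z; rewrite gtr0_norm//; near: z; exact: lt_nbhsr.
  apply: is_derive_eq (is_derive1_comp p0 nx) _.
  by rewrite e /sgn_pow (gtr0_norm xlt0); ring.
Unshelve. all: end_near. Qed.
End sgn_pow.

(** * The pointwise Picone identity *)

Section picone.
Context (R : realType).
Implicit Types (p r s t : R) (D : set R) (f g u v w : R -> R).

Lemma C1_on_continuous D f t : C1_on D f -> D t -> {for t, continuous f}.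
Proof.
move=> fC1 Dt; have [df _] := fC1 t Dt.
exact/differentiable_continuous/derivable1_diffP.
Qed.

Lemma is_derive_div f g t (df dg : R) : g t != 0 ->
  is_derive t 1 f df -> is_derive t 1 g dg ->
  is_derive t 1 (fun s => f s / g s) (df / g t - f t * dg / g t ^+ 2).
Proof.
move=> gt0 hf hg; have hV := is_deriveV gt0 hg.
apply: is_derive_eq (is_deriveM hf hV) _.
by rewrite /GRing.scale/=; field.
Qed.

Lemma C1_on_div D f g : open D -> (forall t, D t -> g t != 0) ->
  C1_on D f -> C1_on D g -> C1_on D (fun t => f t / g t).
Proof.
move=> oD g0 fC1 gC1.
have dq t : D t -> is_derive t 1 (fun s => f s / g s)
    (derive1 f t / g t - f t * derive1 g t / g t ^+ 2).
  move=> Dt; apply: is_derive_div; first exact: g0.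
    by rewrite derive1E; apply: derivableP; apply: (fC1 t Dt).1.
  by rewrite derive1E; apply: derivableP; apply: (gC1 t Dt).1.
move=> t Dt; split; first by have [] := dq t Dt.
have [_ cf'] := fC1 t Dt; have [_ cg'] := gC1 t Dt.
have cf := C1_on_continuous fC1 Dt; have cg := C1_on_continuous gC1 Dt.
(* Openness of D: the formula for the derivative holds on a neighbourhood. *)
have qE : \forall s \near t, (derive1 f s / g s - f s * derive1 g s / g s ^+ 2)
    = derive1 (fun s => f s / g s) s.
  near=> s; rewrite [RHS]derive1E; apply/esym.
  have [//|_ ->//] := dq s _; near: s; exact: open_nbhs_nbhs.
rewrite /prop_for /continuous_at -(nbhs_singleton qE).
apply: cvg_trans (near_eq_cvg qE) _.
have cV : {for t, continuous (fun s => (g s)^-1)}.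
  by apply: continuousV => //; exact: g0.
have cgg : {for t, continuous (fun s => (g s ^+ 2)^-1)}.
  apply: (@continuousV _ _ (fun s => g s ^+ 2)); first by rewrite sqrf_eq0 g0.
  exact: (continuousM cg cg).
apply: cvgB; first exact: cvgM cf' cV.
exact: cvgM (cvgM cf cg') cgg.
Unshelve. all: end_near. Qed.

Lemma continuous_norm_powR p f t : 1 < p -> {for t, continuous f} ->
  {for t, continuous (fun s => `|f s| `^ p)}.
Proof.
move=> p1 cf; apply: (@continuous_comp _ _ _ f (fun z => `|z| `^ p)) => //.
apply/differentiable_continuous/derivable1_diffP.
by have [] := is_derive_norm_powR (f t) p1.
Qed.

Lemma continuous_Cp p f g t : 1 < p -> {for t, continuous f} ->
  {for t, continuous g} -> {for t, continuous (fun s => Cp p (f s) (g s))}.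
Proof.
move=> p1 cf cg; have cfg : {for t, continuous (fun s => f s - g s)}.
  exact: cvgB cf cg.
have csg : {for t, continuous (fun s => sgn_pow p (f s - g s))}.
  apply: (@continuous_comp _ _ _ (fun s => f s - g s) (sgn_pow p)) => //.
  exact: continuous_sgn_pow.
have c1 := continuous_norm_powR p1 cf.
have c2 := continuous_norm_powR p1 cfg.
exact: (cvgB (cvgB c1 c2) (cvgM (cvgM (@cvg_cst _ p _ _ _) csg) cg)).
Qed.

(** With q = u / f, everything is expressed through f, f', q and q'; once the
    powers of products are split, the claim is a polynomial identity in
    [sgn_pow p] of these quantities. *)
Lemma picone_derive p D v w f u t : 1 < p -> D t -> solves_ode p D v w f ->
  0 < f t -> derivable f t 1 -> derivable u t 1 ->
  is_derive t 1
    (fun s => v s * sgn_pow p (derive1 f s) * (f s * `|u s / f s| `^ p))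
    (v t * `|derive1 u t| `^ p - w t * `|u t| `^ p -
     v t * Cp p (derive1 u t) (f t * derive1 (fun s => u s / f s) t)).
Proof.
move=> p1 Dt ode f0 df du; have [dflux odet] := ode t Dt.
have fN0 : f t != 0 by rewrite gt_eqF.
have hf : is_derive t 1 f (derive1 f t).
  by rewrite derive1E; exact: derivableP.
have hu : is_derive t 1 u (derive1 u t).
  by rewrite derive1E; exact: derivableP.
have hq := is_derive_div fN0 hu hf.
have q'E : derive1 (fun s => u s / f s) t =
    derive1 u t / f t - u t * derive1 f t / f t ^+ 2.
  by rewrite derive1E; case: hq.
set q := fun s => u s / f s in hq q'E *.
set q' := derive1 q t.
have uE : u t = f t * q t by rewrite /q; field.
have u'E : derive1 u t = f t * q' + derive1 f t * q t.
  by rewrite /q' q'E /q; field.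
rewrite -q'E -/q' in hq.
have hp := is_derive1_comp (is_derive_norm_powR (q t) p1) hq.
have hfl : is_derive t 1 (fun s => v s * sgn_pow p (derive1 f s))
    (- (w t * sgn_pow p (f t))).
  apply: DeriveDef => //; rewrite -derive1E; apply/eqP.
  by rewrite -addr_eq0; apply/eqP.
apply: is_derive_eq (is_deriveM hfl (is_deriveM hf hp)) _.
rewrite /GRing.scale/= /Cp.
have -> : derive1 u t - f t * q' = derive1 f t * q t by rewrite u'E; ring.
(* The quotient is made opaque: otherwise u would be expanded inside it. *)
rewrite -[(f * _) t]/(f t * `|q t| `^ p) uE.
move: (q t) q' {uE u'E hq hp q'E} => z z'.
rewrite !normrM !powRM// -!(sgn_pow_mul_id _ p1) !sgn_powM.
by ring.
Qed.

End picone.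

(** * Integration over intervals *)

Lemma integrable_setU d (T : measurableType d) (R : realType)
    (mu : {measure set T -> \bar R}) (A B : set T) (f : T -> \bar R) :
  measurable A -> measurable B -> [disjoint A & B] ->
  mu.-integrable A f -> mu.-integrable B f -> mu.-integrable (A `|` B) f.
Proof.
move=> mA mB AB /integrableP[mfA fA] /integrableP[mfB fB].
have mf : measurable_fun (A `|` B) f by apply/measurable_funU.
apply/integrableP; split=> //; rewrite ge0_integral_setU//.
  by rewrite lte_add_pinfty.
exact: measurableT_comp.
Qed.

Section picone_balance.
Context (R : realType).
Notation mu := (@lebesgue_measure R).
Implicit Types (l m r c : R) (f g E P Q : R -> R).

(** The missing point m is negligible. *)
Lemma integrable_oo_cat l m r f : l < m -> m < r ->
  mu.-integrable `]l, m[ (EFin \o f) -> mu.-integrable `]m, r[ (EFin \o f) ->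
  mu.-integrable `]l, r[ (EFin \o f) /\
  \int[mu]_(x in `]l, r[) f x =
    \int[mu]_(x in `]l, m[) f x + \int[mu]_(x in `]m, r[) f x.
Proof.
move=> lm mr if1 if2.
have ioc : mu.-integrable `]l, m] (EFin \o f).
  have /integrableP[mf lf] := if1; apply/integrableP.
  have mfc := (emeasurable_fun_itv_bndo_bndcP _ _ _).1 mf.
  split=> //; rewrite -integral_itv_bndo_bndc//.
  exact: measurableT_comp mf.
have if_lr : mu.-integrable `]l, r[ (EFin \o f).
  rewrite (@itv_bndbnd_setU _ _ _ (BRight m))// ?bnd_simp//; last exact: ltW.
  apply: integrable_setU => //.
  apply/disj_setPS => y [/=]; rewrite 2!in_itv/= => /andP[_ ym] /andP[].
  by rewrite ltNge ym.
split=> //; rewrite (Rintegral_itv_bndo_bndc if1).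
by rewrite -(Rintegral_itvB (x := m) if_lr) ?bnd_simp//; [lra | exact: ltW].
Qed.

(** Integrability travels with the identity, since additivity of the integral
    over adjacent intervals depends on it. *)
Definition picone_balance l r E P Q c :=
  [/\ mu.-integrable `]l, r[ (EFin \o E), mu.-integrable `]l, r[ (EFin \o P),
      mu.-integrable `]l, r[ (EFin \o Q) &
      \int[mu]_(t in `]l, r[) E t - \int[mu]_(t in `]l, r[) P t =
      \int[mu]_(t in `]l, r[) Q t + c].

Lemma picone_balance_cat l m r E P Q c c' : l < m -> m < r ->
  picone_balance l m E P Q c -> picone_balance m r E P Q c' ->
  picone_balance l r E P Q (c + c').
Proof.
move=> lm mr [iE iP iQ e] [iE' iP' iQ' e'].
rewrite /picone_balance; have [jE ->] := integrable_oo_cat lm mr iE iE'.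
have [jP ->] := integrable_oo_cat lm mr iP iP'.
have [jQ ->] := integrable_oo_cat lm mr iQ iQ'.
by split=> //; lra.
Qed.

Lemma eq_picone_balance l r E P Q E' P' Q' c :
  {in `]l, r[, E =1 E'} -> {in `]l, r[, P =1 P'} -> {in `]l, r[, Q =1 Q'} ->
  picone_balance l r E P Q c -> picone_balance l r E' P' Q' c.
Proof.
move=> eE eP eQ [iE iP iQ e].
have tr f g : {in `]l, r[, f =1 g} -> mu.-integrable `]l, r[ (EFin \o f) ->
    mu.-integrable `]l, r[ (EFin \o g) /\
    \int[mu]_(t in `]l, r[) f t = \int[mu]_(t in `]l, r[) g t.
  move=> fg intf; split.
    apply: eq_integrable intf => // x; rewrite inE/= => xlr.
    by rewrite fg.
  by apply: eq_Rintegral => x; rewrite inE/= => xlr; rewrite fg.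
rewrite /picone_balance; have [jE <-] := tr _ _ eE iE.
have [jP <-] := tr _ _ eP iP.
by have [jQ <-] := tr _ _ eQ iQ; split.
Qed.

Lemma picone_balance0 l r : picone_balance l r (cst 0) (cst 0) (cst 0) 0.
Proof.
have i0 : mu.-integrable `]l, r[ (EFin \o cst (0 : R)) by exact: integrable0.
by split=> //; rewrite subrr addr0 /Rintegral integral0.
Qed.

Lemma continuous_integrable_oo l r f :
  {within `[l, r], continuous f} ->
  mu.-integrable `]l, r[ (EFin \o f).
Proof.
move=> cf; have icc := continuous_compact_integrable (@segment_compact R l r) cf.
by apply: integrableS icc => //; exact: subset_itv_oo_cc.
Qed.

(** The integral is taken over the open interval: each of its points has a
    neighbourhood on which the distance function agrees with an affine map. *)
Lemma FTC2_oo l r F f : l < r -> (forall t, t \in `[l, r] ->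
  is_derive t 1 F (f t)) -> {within `[l, r], continuous f} ->
  \int[mu]_(t in `]l, r[) f t = F r - F l.
Proof.
move=> lr dF cf.
have cF t : t \in `[l, r] -> {for t, continuous F}.
  move=> /dF [dFt _]; exact/differentiable_continuous/derivable1_diffP.
have iof := continuous_integrable_oo cf.
have ico : mu.-integrable `[l, r[ (EFin \o f).
  have icc := continuous_compact_integrable (@segment_compact R l r) cf.
  by apply: integrableS icc => //; apply: subset_itvl; rewrite bnd_simp.
rewrite Rintegral_itv_obnd_cbnd// Rintegral_itv_bndo_bndc//.
rewrite /Rintegral (continuous_FTC2 lr cf (F := F))//.
- split.
  + by move=> t tlr; have [] := dF _ (subset_itv_oo_cc tlr).
  + by apply: cvg_at_right_filter; apply: cF; rewrite in_itv/= lexx ltW.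
  + by apply: cvg_at_left_filter; apply: cF; rewrite in_itv/= lexx ltW.
- move=> t tlr; rewrite derive1E.
  by have [_ ->] := dF _ (subset_itv_oo_cc tlr).
Qed.

(** D leaves room around [l, r]: all derivatives are two-sided, and must be
    available at the end points. *)
Lemma picone_integral p (D : set R) (v w f u : R -> R) l r :
  1 < p -> l < r -> open D -> `[l, r] `<=` D ->
  (forall t, D t -> {for t, continuous v}) ->
  (forall t, D t -> {for t, continuous w}) ->
  C1_on D f -> (forall t, D t -> 0 < f t) -> solves_ode p D v w f ->
  C1_on D u ->
  let B s := v s * sgn_pow p (derive1 f s) * (f s * `|u s / f s| `^ p) in
  picone_balance l r (fun t => v t * `|derive1 u t| `^ p)
    (fun t => w t * `|u t| `^ p)
    (fun t => v t * Cp p (derive1 u t) (f t * derive1 (fun s => u s / f s) t))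
    (B r - B l).
Proof.
move=> p1 lr oD lrD cv cw fC1 f0 ode uC1 B.
have fN0 t : D t -> f t != 0 by move=> /f0; exact: lt0r_neq0.
have qC1 := C1_on_div oD fN0 uC1 fC1.
set E := fun t => v t * _; set P := fun t => w t * _; set Q := fun t => v t * _.
have within_of g : (forall t, D t -> {for t, continuous g}) ->
    {within `[l, r], continuous g}.
  by move=> cg; apply: continuous_in_subspaceT => t; rewrite inE => /lrD/cg.
have cE t : D t -> {for t, continuous E}.
  move=> Dt; apply: continuousM; first exact: cv.
  by apply: continuous_norm_powR p1 _; exact: (uC1 t Dt).2.
have cP t : D t -> {for t, continuous P}.
  move=> Dt; apply: continuousM; first exact: cw.
  by apply: continuous_norm_powR p1 _; exact: C1_on_continuous uC1 Dt.
have cQ t : D t -> {for t, continuous Q}.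
  move=> Dt; apply: continuousM; first exact: cv.
  apply: continuous_Cp p1 _ _; first exact: (uC1 t Dt).2.
  apply: continuousM; first exact: C1_on_continuous fC1 Dt.
  exact: (qC1 t Dt).2.
have iE := continuous_integrable_oo (within_of _ cE).
have iP := continuous_integrable_oo (within_of _ cP).
have iQ := continuous_integrable_oo (within_of _ cQ).
split=> //.
have cEPQ : {within `[l, r], continuous (fun t => E t - P t - Q t)}.
  apply: within_of => t Dt.
  exact: (cvgB (cvgB (cE t Dt) (cP t Dt)) (cQ t Dt)).
have : \int[mu]_(t in `]l, r[) (E t - P t - Q t) = B r - B l.
  apply: FTC2_oo => // t /lrD Dt.
  exact: picone_derive p1 Dt ode (f0 t Dt) (fC1 t Dt).1 (uC1 t Dt).1.
rewrite RintegralB//; last first.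
  by have := integrableB _ iE iP; apply.
rewrite RintegralB// => e; lra.
Qed.

End picone_balance.

(** * Invariance under isometries of the line *)

Section isometry.
Context (R : realType) (sigma c : R).
Let iso (s : R) : R := sigma * s + c.

Let is_derive_iso (t : R) : is_derive t (1 : R) iso sigma.
Proof.
have h := is_deriveD (is_deriveZ sigma (is_derive_id t (1 : R)))
  (is_derive_cst c t (1 : R)).
by apply: is_derive_eq h _; rewrite /GRing.scale/= mulr1 addr0.
Qed.

Let continuous_iso (t : R) : {for t, continuous iso}.
Proof.
apply/differentiable_continuous/derivable1_diffP.
by have [] := is_derive_iso t.
Qed.

Lemma derive1_iso (f : R -> R) t : derivable f (iso t) 1 ->
  derive1 (f \o iso) t = sigma * derive1 f (iso t).
Proof.
move=> df; have [di ie] := is_derive_iso t.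
by rewrite (derive1_comp di df) [derive1 iso t]derive1E ie mulrC.
Qed.

Lemma near_iso (D : set R) t : open D -> D (iso t) ->
  \forall s \near t, D (iso s).
Proof.
move=> oD Dt; have : nbhs (iso t) D by exact: open_nbhs_nbhs.
by move=> /continuous_iso.
Qed.

Lemma open_iso (D : set R) : open D -> open (iso @^-1` D).
Proof. by move=> oD; apply: open_comp => // t _; exact: continuous_iso. Qed.

Lemma continuous_comp_iso (f : R -> R) t : {for iso t, continuous f} ->
  {for t, continuous (f \o iso)}.
Proof. by move=> cf; apply: continuous_comp => //; exact: continuous_iso. Qed.

Lemma C1_on_iso (D : set R) f : open D -> C1_on D f ->
  C1_on (iso @^-1` D) (f \o iso).
Proof.
move=> oD fC1 t Dt; have [df cf'] := fC1 _ Dt; split.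
  by have [] := is_derive1_comp (derivableP df) (is_derive_iso t).
have eqf : \forall s \near t, sigma * derive1 f (iso s) = derive1 (f \o iso) s.
  by apply: filterS (near_iso oD Dt) => s Ds; rewrite (derive1_iso (fC1 _ Ds).1).
rewrite /prop_for /continuous_at -(nbhs_singleton eqf).
apply: cvg_trans (near_eq_cvg eqf) _.
exact: cvgM (@cvg_cst _ sigma _ _ _) (continuous_comp_iso cf').
Qed.

Lemma sgn_pow_signM p x : sigma * sigma = 1 ->
  sgn_pow p (sigma * x) = sigma * sgn_pow p x.
Proof.
move=> sigma2; have s1 : `|sigma| = 1.
  by apply/eqP; rewrite -(@eqrXn2 _ 2)// -normrX expr2 sigma2 normr1 expr1n.
by rewrite sgn_powM {1}/sgn_pow s1 powR1 mul1r.
Qed.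

(** The flux of f o iso is sigma times that of f: it is odd in the derivative.
    Differentiating brings out a second factor sigma, and sigma^2 = 1. *)
Lemma solves_ode_iso p (D : set R) (v w f : R -> R) :
  sigma * sigma = 1 -> open D -> C1_on D f -> solves_ode p D v w f ->
  solves_ode p (iso @^-1` D) (v \o iso) (w \o iso) (f \o iso).
Proof.
move=> sigma2 oD fC1 ode flux t Dt; have [dF Fe] := ode _ Dt.
set F := fun s => v s * sgn_pow p (derive1 f s) in dF Fe.
have hF : is_derive t 1 flux (derive1 F (iso t)).
  have h := is_deriveZ sigma (is_derive1_comp (derivableP dF) (is_derive_iso t)).
  apply: near_eq_is_derive; last first.
    apply: is_derive_eq h _; rewrite /GRing.scale/= derive1E.
    by rewrite mulrCA sigma2 mulr1.
  apply: filterS (near_iso oD Dt) => s Ds.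
  rewrite /flux (derive1_iso (fC1 _ Ds).1) (sgn_pow_signM _ _ sigma2).
  by rewrite /F/= [RHS]mulrCA.
have [d e] := hF.
split; first exact: d.
by rewrite derive1E e; exact: Fe.
Qed.

End isometry.

(** * The distance function and test functions *)

Section distance.
Context (R : realType).
Implicit Types (p : R).

Lemma open_pos_interval (R' : \bar R) : open (@pos_interval R R').
Proof.
case: R' => [r| |].
- rewrite (_ : pos_interval _ = `]0, r[%classic); first exact: interval_open.
  by apply/seteqP; split=> x; rewrite /pos_interval /= in_itv/= lte_fin => /andP.
- rewrite (_ : pos_interval _ = `]0, +oo[%classic); first exact: interval_open.
  apply/seteqP; split=> x; rewrite /pos_interval /= in_itv/= andbT.
    by case.
  by move=> x0; split=> //; exact: ltry.
- rewrite (_ : pos_interval _ = set0); first exact: open0.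
  by apply/seteqP; split=> x //= [].
Qed.

(** d has to agree with the affine map on the open interval only, since at the
    midpoint the distance function has a kink. *)
Lemma picone_distance p (R' : \bar R) (V W phi u d : R -> R) (sigma c l r : R) :
  1 < p -> bessel_pair p R' V W -> positive_solution p R' V W phi ->
  sigma * sigma = 1 -> l < r ->
  (forall t, t \in `]l, r[ -> d t = sigma * t + c) ->
  (forall t, t \in `[l, r] -> pos_interval R' (sigma * t + c)) ->
  C1_on setT u ->
  let B s := sigma * V (sigma * s + c) *
    sgn_pow p (derive1 phi (sigma * s + c)) *
    (phi (sigma * s + c) * `|u s / phi (sigma * s + c)| `^ p) in
  picone_balance l r (fun t => V (d t) * `|derive1 u t| `^ p)
    (fun t => W (d t) * `|u t| `^ p)
    (fun t => V (d t) *
       Cp p (derive1 u t) (phi (d t) * derive1 (fun s => u s / phi (d s)) t))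
    (B r - B l).
Proof.
move=> p1 [_ [VC1 _] [WC1 _] _] [phiC1 phi0 ode _] s2 lr dE lrD uC1 B.
have oD := @open_pos_interval R'.
pose iso s := sigma * s + c; pose D := iso @^-1` pos_interval R'.
have := picone_integral (D := D) (v := V \o iso) (w := W \o iso)
  (f := phi \o iso) (u := u) p1 lr (@open_iso _ sigma c _ oD) lrD.
case=> [t Dt|t Dt|||||iE iP iQ e].
- by apply: continuous_comp_iso; exact: C1_on_continuous VC1 Dt.
- by apply: continuous_comp_iso; exact: C1_on_continuous WC1 Dt.
- exact: C1_on_iso.
- by move=> t /phi0.
- exact: solves_ode_iso.
- by move=> t _; exact: uC1.
have BE s : s \in `[l, r] -> (V \o iso) s * sgn_pow p (derive1 (phi \o iso) s) *
    ((phi \o iso) s * `|u s / (phi \o iso) s| `^ p) = B s.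
  move=> /lrD Ds; rewrite (derive1_iso (phiC1 _ Ds).1).
  by rewrite (sgn_pow_signM _ _ s2) /B /= /iso; ring.
have rlr : r \in `[l, r] by rewrite in_itv/= lexx ltW.
have llr : l \in `[l, r] by rewrite in_itv/= lexx ltW.
rewrite -(BE _ rlr) -(BE _ llr).
apply: eq_picone_balance (And4 iE iP iQ e) => t tlr /=.
- by rewrite dE.
- by rewrite dE.
- rewrite dE//; congr (_ * Cp _ _ (_ * _)).
  rewrite !derive1E; apply: near_eq_derive.
  have : \forall s \near t, s \in `]l, r[ by exact: near_in_itvoo.
  by apply: filterS => s slr; rewrite dE.
Qed.

Lemma balance_vanishing p (V W f u : R -> R) (l r : R) : 1 < p ->
  (forall t, t \in `]l, r[ -> u t = 0) ->
  picone_balance l r (fun t => V t * `|derive1 u t| `^ p)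
    (fun t => W t * `|u t| `^ p)
    (fun t => V t * Cp p (derive1 u t) (f t * derive1 (fun s => u s / f s) t)) 0.
Proof.
move=> p1 u0; have pN0 : p != 0 by rewrite gt_eqF// (lt_trans _ p1).
have d0 (g : R -> R) t : (forall s, s \in `]l, r[ -> g s = 0) -> t \in `]l, r[ ->
    derive1 g t = 0.
  move=> g0 tlr; rewrite derive1E; transitivity ('D_1 (cst (0 : R)) t).
    apply: near_eq_derive.
    have : \forall s \near t, s \in `]l, r[ by exact: near_in_itvoo.
    by apply: filterS => s /g0.
  exact: derive_cst.
apply: eq_picone_balance (picone_balance0 l r) => t tlr /=.
- by rewrite d0// normr0 powR0// mulr0.
- by rewrite u0// normr0 powR0// mulr0.
- rewrite (d0 u)// (d0 (fun s => u s / f s))//; last first.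
    by move=> s slr; rewrite u0// mul0r.
  by rewrite mulr0 /Cp subr0 normr0 subrr mulr0 subrr mulr0.
Qed.

(** Why a test function vanishes near the ends of its interval: they lie outside
    its closed support. *)
Lemma vanish_near (u : R -> R) x : ~ closure [set t | u t != 0] x ->
  exists2 e : R, 0 < e & forall t, `|x - t| < e -> u t = 0.
Proof.
move=> nx; have : nbhs x (~` closure [set t | u t != 0]).
  apply: open_nbhs_nbhs; split=> //; apply: closed_openC; exact: closed_closure.
move=> /nbhs_ballP[e /= e0 He]; exists e => // t xt.
have [//|ut] := eqVneq (u t) 0.
by case: (He t xt); exact: subset_closure.
Qed.

Lemma test_function_C1 (a b : R) (u : R -> R) : test_function a b u -> C1_on setT u.
Proof.
move=> [du _ _] t _; split; first exact: (du 0%N).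
apply/differentiable_continuous/derivable1_diffP; exact: (du 1%N).
Qed.
End distance.

(** * The identity on the whole interval *)

Unset Implicit Arguments.
Set Strict Implicit.
Theorem theorem3p1 (R : realType) (a b p : R) (R' : \bar R)
    (V W phi : R -> R) :
  a < b -> 1 < p -> (((b - a) / 2)%:E < R')%E ->
  bessel_pair p R' V W -> positive_solution p R' V W phi ->
  let mu := @lebesgue_measure R in
  let rho := (b - a) / 2 in
  let d := fun t : R => Num.min (t - a) (b - t) in
  let E := fun (u : R -> R) (t : R) => V (d t) * `|derive1 u t| `^ p in
  let P := fun (u : R -> R) (t : R) => W (d t) * `|u t| `^ p in
  let Q := fun (u : R -> R) (t : R) =>
    V (d t) * Cp p (derive1 u t) (phi (d t) * derive1 (fun s => u s / phi (d s)) t) in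
  (forall u : R -> R, test_function a b u ->
    [/\ mu.-integrable `]a, b[ (EFin \o E u),
        mu.-integrable `]a, b[ (EFin \o P u),
        mu.-integrable `]a, b[ (EFin \o Q u) &
        \int[mu]_(t in `]a, b[) E u t - \int[mu]_(t in `]a, b[) P u t =
        \int[mu]_(t in `]a, b[) Q u t +
        2 * (V rho * (`|derive1 phi rho| `^ (p - 2) * derive1 phi rho)
             / phi rho `^ (p - 1)) * `|u ((a + b) / 2)| `^ p])
  /\
  (derive1 phi rho = 0 ->
   forall u : R -> R, test_function a b u ->
     \int[mu]_(t in `]a, b[) E u t - \int[mu]_(t in `]a, b[) P u t =
     \int[mu]_(t in `]a, b[) Q u t).
Proof.
move=> ab p1 rhoR' bp ps mu rho d E P Q.
(* The critical point case drops the midpoint term of the general identity. *)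
suff main (u : R -> R) : test_function a b u ->
  picone_balance a b (E u) (P u) (Q u)
    (2 * (V rho * (`|derive1 phi rho| `^ (p - 2) * derive1 phi rho)
       / phi rho `^ (p - 1)) * `|u ((a + b) / 2)| `^ p).
  split=> [u /main //|phi'0 u /main [_ _ _ ->]].
  by rewrite phi'0 !(mulr0, mul0r) addr0.
move=> tu; have uC1 := test_function_C1 tu.
have [_ _ suppu] := tu.
have [e e0 ue] : exists2 e : R, 0 < e & forall t, `|a - t| < e -> u t = 0.
  by apply: vanish_near => /suppu /=; rewrite in_itv/= ltxx.
have [e' e'0 ue'] : exists2 e : R, 0 < e & forall t, `|b - t| < e -> u t = 0.
  by apply: vanish_near => /suppu /=; rewrite in_itv/= ltxx andbF.
have rho0 : 0 < rho by rewrite /rho; lra.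
pose m := (a + b) / 2.
have am : m - a = rho by rewrite /m /rho; lra.
have bm : b - m = rho by rewrite /m /rho; lra.
(* Halved so that a + k and b - k are still inside the zones where u vanishes,
   and on the correct sides of the midpoint m. *)
pose k := Num.min e (Num.min e' rho) / 2.
have k0 : 0 < k by rewrite divr_gt0// !lt_min e0 e'0 rho0.
have [ke ke' krho] : [/\ k < e, k < e' & k < rho].
  have : 2 * k <= e /\ 2 * k <= e' /\ 2 * k <= rho.
    by rewrite /k mulrC divfK ?pnatr_eq0// !ge_min !lexx !orbT.
  by move=> [? [? ?]]; split; lra.
have ua t : t \in `]a, a + k] -> u t = 0.
  rewrite in_itv/= => /andP[at_ ta]; apply: ue.
  by rewrite ltr0_norm; lra.
have ub t : t \in `[b - k, b[ -> u t = 0.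
  rewrite in_itv/= => /andP[bt tb]; apply: ue'.
  by rewrite gtr0_norm; lra.
have u_ak : u (a + k) = 0 by apply: ua; rewrite in_itv/=; lra.
have u_bk : u (b - k) = 0 by apply: ub; rewrite in_itv/=; lra.
have rhoD s : 0 < s -> s <= rho -> pos_interval R' s.
  by move=> s0 sr; split=> //; rewrite (le_lt_trans _ rhoR')// lee_fin.
have phirho : 0 < phi rho by case: ps => _ + _ _; apply; apply: rhoD.
have pieceL : picone_balance a (a + k) (E u) (P u) (Q u) 0.
  apply: (balance_vanishing (V \o d) (W \o d) (phi \o d) p1) => t.
  by rewrite in_itv/= => /andP[? ?]; apply: ua; rewrite in_itv/=; lra.
have pieceR : picone_balance (b - k) b (E u) (P u) (Q u) 0.
  apply: (balance_vanishing (V \o d) (W \o d) (phi \o d) p1) => t.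
  by rewrite in_itv/= => /andP[? ?]; apply: ub; rewrite in_itv/=; lra.
have vanish0 x : `|0 / x| `^ p = 0 :> R.
  by rewrite mul0r normr0 powR0// gt_eqF// (lt_trans _ p1).
have key : phi rho * `|u m / phi rho| `^ p = `|u m| `^ p / phi rho `^ (p - 1).
  have inv_pow : (phi rho)^-1 `^ p = (phi rho * phi rho `^ (p - 1))^-1.
    rewrite -(powR_inv1 (ltW phirho)) -powRrM mulN1r powRN.
    by rewrite (mulr_powRB1 (ltW phirho))// (lt_trans _ p1).
  have pow_neq0 : phi rho `^ (p - 1) != 0 by rewrite gt_eqF// powR_gt0.
  have phi_neq0 : phi rho != 0 by rewrite gt_eqF.
  rewrite normrM powRM// normfV (gtr0_norm phirho) inv_pow.
  by field; rewrite pow_neq0.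
have leftP : picone_balance (a + k) m (E u) (P u) (Q u)
    (V rho * sgn_pow p (derive1 phi rho) * (`|u m| `^ p / phi rho `^ (p - 1))).
  have := @picone_distance R p R' V W phi u d 1 (- a) (a + k) m p1 bp ps.
  case=> [||t|t||iE iP iQ eq].
  - by rewrite mulr1.
  - by lra.
  - rewrite in_itv/= => /andP[? ?]; rewrite /d min_l; lra.
  - by rewrite in_itv/= => /andP[? ?]; apply: rhoD; lra.
  - exact: uC1.
  split; [exact: iE | exact: iP | exact: iQ | apply: (etrans eq); congr (_ + _)].
  by rewrite !mul1r am key u_ak vanish0 !mulr0 subr0.
have rightP : picone_balance m (b - k) (E u) (P u) (Q u)
    (V rho * sgn_pow p (derive1 phi rho) * (`|u m| `^ p / phi rho `^ (p - 1))).
  have := @picone_distance R p R' V W phi u d (-1) b m (b - k) p1 bp ps.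
  case=> [||t|t||iE iP iQ eq].
  - by rewrite mulrNN mulr1.
  - by lra.
  - rewrite in_itv/= => /andP[? ?]; rewrite /d min_r; lra.
  - by rewrite in_itv/= => /andP[? ?]; apply: rhoD; lra.
  - exact: uC1.
  split; [exact: iE | exact: iP | exact: iQ | apply: (etrans eq); congr (_ + _)].
  rewrite !mulN1r [- m + b]addrC bm key u_bk vanish0.
  by rewrite !mulr0 sub0r !mulNr opprK.
have ltL : a < a + k by lra.
have ltR : b - k < b by lra.
have ltLm : a + k < m by lra.
have ltmR : m < b - k by lra.
have am' : a < m by lra.
have mb' : m < b by lra.
have := picone_balance_cat am' mb'
  (picone_balance_cat ltL ltLm pieceL leftP)
  (picone_balance_cat ltmR ltR rightP pieceR).
congr (picone_balance _ _ _ _ _ _).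
by rewrite /m /sgn_pow; ring.
Qed.
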